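(* Let $\mu,\sigma,X,T,G,V,\mathcal{C},\mathcal{D},\mathbb{L}_X$ be as in the context. Assume: (i) $\mu$ and $\sigma$ are locally Lipschitz, $\mu$ is piecewise-$C^2$, $\sigma>0$ and $\sigma$ is piecewise-$C^3$; (ii) $G:[0,T]\times\mathbb{R}\to\mathbb{R}$ is upper semi-continuous; (iii) $V$ is continuous on $(0,T)\times\mathbb{R}$; (iv) there exists a free-boundary $\{b(t),\,0\le t\le T\}$ such that $\mathcal{C}=\{(t,x): t\in[0,T),\ x>b(t)\}$ and $\mathcal{D}=\{(t,x): t\in[0,T),\ x\le b(t)\}\cup(\{T\}\times\mathbb{R})$; (v) for any $t\in[0,T)$ there exist $\varepsilon>0$ and a ball $\mathcal{B}:=\mathcal{B}^{\varepsilon}_{t,b(t)}$ centered at $(t,b(t))$ with radius $\varepsilon$ such that $G\in C^{1,2}(\overline{\mathcal{B}\cap\mathcal{C}})$; (vi) there exist $\varepsilon>0$ and $\mathcal{B}$ as in (v) (for each $t\in[0,T)$) and a constant $\ell_\varepsilon>0$ such that $H:=G_t+\mathbb{L}_XG\le-\ell_\varepsilon$ in $\overline{\mathcal{B}\cap\mathcal{C}}$; (vii) there exists $\delta>1$ such that the map $$\kappa(t,x):=\mathsf{E}_x\Big[\sup_{0\le s\le T-t}\big|G(t+s,X_s)\big|^\delta\Big]$$ satisfies $\sup_{0\le t\le T}\int_{-R}^R|\kappa(t,x)|^{1/\delta}dx<\infty$ for any fixed $R>0$. Let $[t_1,t_2]\subset[0,T]$ be a time interval on which the free-boundary $b$ is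 increasing. Then $t\mapsto b(t)$ is continuous on $[t_1,t_2]$.
   Context: Let $(\Omega,\mathcal{F},\mathsf{P})$ be a complete probability space with the natural filtration $\mathbb{F}=(\mathcal{F}_t)_{t\ge0}$ (completed with $\mathsf{P}$-null sets) of a one dimensional standard Brownian motion $B$. For $\mu:\mathbb{R}\to\mathbb{R}$ and $\sigma:\mathbb{R}\to\mathbb{R}_+$, $X=(X_t)_{t\ge0}$ is the real process that uniquely solves, in the strong sense, $dX_t=\mu(X_t)dt+\sigma(X_t)dB_t$, $X_0=x$. $\mathsf{P}_x$ is the probability measure induced by $X$ started at time zero from $x$, with expectation $\mathsf{E}_x$. Its infinitesimal generator is $\mathbb{L}_Xf(x)=\frac{\sigma^2(x)}{2}f''(x)+\mu(x)f'(x)$, acting on the space variable. Fix $0<T<\infty$ and $G:[0,T]\times\mathbb{R}\to\mathbb{R}$ (the gain function). The value function is $$V(t,x):=\sup_{0\le\tau\le T-t}\mathsf{E}_x\big[G(t+\tau,X_\tau)\big],$$ the supremum being over all $\mathbb{F}$-stopping times in $[0,T-t]$. The continuation set is $\mathcal{C}:=\{V>G\}$ and the stopping set is $\mathcal{D}:=\{V=G\}$. Standing assumptions: the stopping time $\tau_*(t,x):=\inf\{s\ge0: V(t+s,X_s)=G(t+s,X_s)\}\wedge(T-t)$ under $\mathsf{P}_x$ is optimal for $V(t,x)$; $\mathcal{C}$ is open and $\mathcal{D}$ is closed in $[0,T]\times\mathbb{R}$. By standard Markovian arguments $V\in C^{1,2}$ inside $\mathcal{C}$ and $V_t+\mathbb{L}_XV=0$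 in $\mathcal{C}$. ''Increasing'' on an interval means $b(s)\le b(t)$ whenever $s\le t$ in the interval.
   Formalization: Since (iv) puts no condition on b(T), the claim can fail at t_2 = T (raise b(T) arbitrarily); the formal statement adds the convention that b(T) equals the left limit of b at T whenever that finite limit exists. *)

(* Defs.v *)
From HB Require Import structures.
From mathcomp Require Import all_boot all_order all_algebra.
From mathcomp Require Import all_classical all_reals all_analysis.
Set Implicit Arguments.
Unset Strict Implicit.
Unset Printing Implicit Defensive.
Import Order.TTheory GRing.Theory Num.Theory.
Import numFieldNormedType.Exports.
Local Open Scope classical_set_scope.
Local Open Scope ring_scope.

(* Time is indexed by R; only nonnegative times are ever constrained. *)

Section regularity.
Context {R : realType}.
Implicit Types (f : R -> R) (A : set (R * R)).

Definition locally_lipschitz f : Prop :=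
  forall M : R, [lipschitz f x | x in `[- M, M]].

(* C^k off a locally finite set N, all derivatives of order at most k having
   finite one-sided limits at the points of N, i.e. f is C^k up to the
   endpoints on each piece. *)
Definition piecewise_Ck (k : nat) f : Prop :=
  exists N : set R,
    [/\ forall a c : R, finite_set (N `&` `[a, c]),
        forall x (j : nat), ~ N x -> (j < k)%N -> derivable (derive1n j f) x 1,
        forall x (j : nat), ~ N x -> (j <= k)%N -> {for x, continuous (derive1n j f)}
      & forall x (j : nat), N x -> (j <= k)%N ->
          cvg (derive1n j f y @[y --> x^'-]) /\ cvg (derive1n j f y @[y --> x^'+])].

Definition upper_semicontinuous_on A (g : R * R -> R) : Prop :=
  forall z, A z -> forall a : R, g z < a -> \forall w \near within A (nbhs z), g w < a.

Definition open_in (S A : set (R * R)) : Prop := exists2 U, open U & A = U `&` S.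
Definition closed_in (S A : set (R * R)) : Prop := exists2 F, closed F & A = F `&` S.

(* ft, fx, fxx are the derivatives f_t, f_x, f_xx in the interior of A, and
   f, ft, fx, fxx are continuous on S.  With S := A this is C^{1,2} on an open
   set A; with S := closure A it is C^{1,2}(closure A), the values of ft, fx,
   fxx on the boundary being the continuous extensions of the derivatives. *)
Definition is_C12 A (S : set (R * R)) (f ft fx fxx : R -> R -> R) : Prop :=
  (forall t x : R, A° (t, x) ->
    [/\ is_derive t 1 (fun s : R => f s x) (ft t x),
        is_derive x 1 (fun y : R => f t y) (fx t x)
      & is_derive x 1 (fun y : R => fx t y) (fxx t x)]) /\
  [/\ {within S, continuous (fun z => f z.1 z.2)},
      {within S, continuous (fun z => ft z.1 z.2)},
      {within S, continuous (fun z => fx z.1 z.2)}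
    & {within S, continuous (fun z => fxx z.1 z.2)}].

(* The product of R with itself carries the sup norm, hence an explicit
   Euclidean ball. *)
Definition eball (t x e : R) : set (R * R) :=
  [set z | (z.1 - t) ^+ 2 + (z.2 - x) ^+ 2 < e ^+ 2].

(* f_t + L_X f at (t, x), given the values ft, fx, fxx of the derivatives of f. *)
Definition parabolic_op (mu sigma : R -> R) (ft fx fxx : R -> R -> R) (t x : R) : R :=
  ft t x + (sigma x ^+ 2 / 2 * fxx t x + mu x * fx t x).

End regularity.

Section stochastic.
Context {d : measure_display} {Omega : measurableType d} {R : realType}.
Variable P : probability Omega R.
Implicit Types (B X Y H : R -> Omega -> R) (Fi : R -> set (set Omega)).

Definition cvg_in_probability (Yn : nat -> Omega -> \bar R) : Prop :=
  forall e : R, 0 < e -> P [set w | (e%:E < `|Yn n w|)%E] @[n --> \oo] --> 0%E.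

Definition past_events B (t : R) : set (set Omega) :=
  [set A | exists s : R, exists2 E : set R,
     0 <= s <= t /\ measurable E & A = B s @^-1` E].

Definition completed_filtration B (t : R) : set (set Omega) :=
  <<s past_events B t `|` P.-negligible >>.

Definition is_brownian_motion B : Prop :=
  [/\ forall t : R, 0 <= t -> measurable_fun setT (B t),
      {ae P, forall w, B 0 w = 0},
      {ae P, forall w, {within `[0, +oo[, continuous (fun t => B t w)}},
      forall (s t : R) (E : set R), 0 <= s < t -> measurable E ->
        P ((B t \- B s)%R @^-1` E) = normal_prob 0 (Num.sqrt (t - s)) E
    & forall (s t : R) (A : set Omega) (E : set R), 0 <= s < t ->
        <<s past_events B s >> A -> measurable E ->
        P (A `&` (B t \- B s)%R @^-1` E) = (P A * P ((B t \- B s)%R @^-1` E))%E].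

Definition adapted Fi X : Prop :=
  forall (t : R) (E : set R), 0 <= t -> measurable E -> Fi t (X t @^-1` E).

(* The simple process \sum_(i < n) xi_i * 1_{]t_i, t_{i+1}]}. *)
Record simple_process := SimpleProcess {
  sp_size : nat;
  sp_time : nat -> R;
  sp_val : nat -> Omega -> R }.

Definition admissible_simple Fi (Z : simple_process) : Prop :=
  [/\ 0 <= sp_time Z 0,
      forall i, (i < sp_size Z)%N -> sp_time Z i <= sp_time Z i.+1,
      forall i (E : set R), (i < sp_size Z)%N -> measurable E ->
        Fi (sp_time Z i) (sp_val Z i @^-1` E)
    & forall i, (i < sp_size Z)%N -> exists M, forall w, `|sp_val Z i w| <= M].

Definition simple_eval (Z : simple_process) (s : R) (w : Omega) : R :=
  \sum_(i < sp_size Z) sp_val Z i w * \1_(`]sp_time Z i, sp_time Z i.+1]) s.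

Definition simple_integral B (Z : simple_process) (t : R) (w : Omega) : R :=
  \sum_(i < sp_size Z) sp_val Z i w *
     (B (Num.min (sp_time Z i.+1) t) w - B (Num.min (sp_time Z i) t) w).

(* The random variable I is (a version of) the Ito integral of H against B over
   [0, t]: the limit in probability of the integrals of simple adapted
   processes Z_n such that \int_0^t |Z_n - H|^2 ds tends to 0 in probability. *)
Definition is_ito_integral B Fi H (t : R) (I : Omega -> R) : Prop :=
  exists Z : nat -> simple_process,
    [/\ forall n, admissible_simple Fi (Z n),
        cvg_in_probability (fun n w =>
          \int[lebesgue_measure]_(s in `[0%R, t])
             ((simple_eval (Z n) s w - H s w) ^+ 2)%:E)%E
      & cvg_in_probability (fun n w => (simple_integral B (Z n) t w - I w)%:E)].

Definition sde_solution (mu sigma : R -> R) B (x : R) X : Prop :=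
  [/\ adapted (completed_filtration B) X,
      {ae P, forall w, {within `[0, +oo[, continuous (fun t => X t w)}},
      {ae P, forall w, X 0 w = x}
    & forall t : R, 0 <= t ->
        is_ito_integral B (completed_filtration B) (fun s w => sigma (X s w)) t
          (fun w => X t w - x -
             \int[lebesgue_measure]_(s in `[0, t]) mu (X s w))].

Definition unique_strong_solution (mu sigma : R -> R) B (x : R) X : Prop :=
  sde_solution mu sigma B x X /\
  forall Y, sde_solution mu sigma B x Y ->
    {ae P, forall w, forall t : R, 0 <= t -> Y t w = X t w}.

(* Stopping times with values in [0, S]. *)
Definition stopping_time Fi (S : R) (tau : Omega -> R) : Prop :=
  (forall w, 0 <= tau w <= S) /\ (forall s : R, 0 <= s -> Fi s [set w | tau w <= s]).

(* In what follows X x is the diffusion started from x, so that E_x[F(X)] is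
   the expectation of F(X x) under P. *)
Definition payoff (G : R -> R -> R) (X : R -> R -> Omega -> R) (t x : R)
    (tau : Omega -> R) : \bar R :=
  ('E_P[fun w => G (t + tau w)%R (X x (tau w) w)])%E.

Definition value Fi (G : R -> R -> R) (X : R -> R -> Omega -> R) (T t x : R) : \bar R :=
  ereal_sup [set payoff G X t x tau | tau in stopping_time Fi (T - t)].

(* inf {s | V = G} /\ (T - t): T - t is put in the set because inf set0 = 0. *)
Definition tau_star (G V : R -> R -> R) (X : R -> R -> Omega -> R) (T t x : R)
    (w : Omega) : R :=
  inf ([set s : R | 0 <= s <= T - t /\ V (t + s) (X x s w) = G (t + s) (X x s w)]
       `|` [set T - t]).

Definition kappa (G : R -> R -> R) (X : R -> R -> Omega -> R) (T delta t x : R) : \bar R :=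
  (\int[P]_w ereal_sup
     [set (`|G (t + s) (X x s w)| `^ delta)%R%:E | s in `[0%R, (T - t)%R]])%E.

End stochastic.

Section regions.
Context {R : realType}.

Definition strip (T : R) : set (R * R) := [set z | 0 <= z.1 <= T].

Definition continuation_set (T : R) (V G : R -> R -> R) : set (R * R) :=
  [set z | strip T z /\ G z.1 z.2 < V z.1 z.2].

Definition stopping_set (T : R) (V G : R -> R -> R) : set (R * R) :=
  [set z | strip T z /\ V z.1 z.2 = G z.1 z.2].

End regions.

(* Main.v *)
Require Import Defs.
From HB Require Import structures.
From mathcomp Require Import all_boot all_order all_algebra.
From mathcomp Require Import all_classical all_reals all_analysis.
From mathcomp Require Import ring lra.
Import Order.TTheory GRing.Theory Num.Theory.
Import numFieldNormedType.Exports.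
Local Open Scope classical_set_scope.
Local Open Scope ring_scope.

(** The continuation set is open, so [b] is upper semicontinuous, and an
    increasing [b] can only jump upwards from the left.  At such a jump time
    [t0 < T] the function [u := V - G] satisfies [u_t + L_X u >= l > 0] and
    [u > 0] on a rectangle ending at [t0], with [u = 0] at time [t0].  The
    quadratic barrier [w(t, x) := K (x - x0)^2 - l (t0 - t) / 2] with [K] small
    contradicts this: by the parabolic maximum principle [u <= w] just before
    [t0], and [w < 0] at [x0].  At [t0 = T] there is nothing to prove, since
    [b T] is the left limit. *)

(** * First and second order conditions at an interior maximum *)

Lemma is_derive_gt0_incr_right (R : realType) (f : R -> R) (x df : R) :
  is_derive x 1 f df -> 0 < df ->
  exists2 e : R, 0 < e & forall y, x < y < x + e -> f x < f y.
Proof.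
move=> [dfx <-] /(cvgr_gt ('D_1 f x) dfx) /nbhs_ballP[e /= e0 ball_e].
exists e => // y /andP[xy yxe].
have := ball_e (y - x).
rewrite /ball /= sub0r normrN gtr0_norm ?subr_gt0// ltrBlDl => /(_ yxe).
rewrite subr_eq0 gt_eqF // => /(_ isT).
by rewrite /= [_%:A]mulr1 subrK pmulr_rgt0 ?invr_gt0 ?subr_gt0.
Qed.

(** The first claim is Fermat's theorem. If [d] were positive, [g] would be positive just to the
    right of [c], and the mean value theorem would give a point [y] with [f y > f c]. *)
Lemma second_derivative_at_max (R : realType) (f g : R -> R) (a b c d : R) :
  c \in `]a, b[ ->
  (forall x, x \in `]a, b[ -> is_derive x 1 f (g x)) -> is_derive c 1 g d ->
  (forall x, x \in `]a, b[ -> f x <= f c) -> g c = 0 /\ d <= 0.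
Proof.
move=> cab df dg cmax; have /andP[ac cb] : a < c < b by move: cab; rewrite in_itv.
have gc0 : g c = 0.
  have [_ <-] := df c cab.
  by have [] := derive1_at_max (ltW (lt_trans ac cb))
    (fun t tab => @ex_derive _ _ _ _ _ _ _ (df t tab)) cab cmax.
split=> //; rewrite leNgt; apply/negP => d0.
have [e e0] := is_derive_gt0_incr_right R g c d dg d0; rewrite gc0 => gpos.
have [y [cy ye yb]] : exists y, [/\ c < y, y < c + e & y < b].
  exists (Num.min (c + e / 2) ((c + b) / 2)).
  by case: (leP (c + e / 2) ((c + b) / 2)) => ?; split; lra.
have sub z : c <= z <= y -> z \in `]a, b[ by rewrite in_itv/= => ?; lra.
have fd x : x \in `]c, y[ -> is_derive x 1 f (g x).
  by rewrite in_itv/= => xcy; apply: df; apply: sub; lra.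
have fc : {within `[c, y], continuous f}.
  apply: derivable_within_continuous => x; rewrite in_itv/= => xcy.
  by have [] := df x (sub _ xcy).
have [z zcy fE] := MVT cy fd fc.
have := cmax y (sub y _); have : 0 < g z by apply: gpos; move: zcy; rewrite in_itv/=; lra.
move=> gz /(_ _); have : 0 < g z * (y - c) by rewrite mulr_gt0 ?subr_gt0.
have -> : c <= y <= y by lra.
by rewrite -fE => ? /(_ isT); lra.
Qed.

(** * Parabolic maximum principle with a quadratic barrier *)

(** If [u] were nonnegative at [(a, x0)] with [a] close to [t0], then [v], which is [u] minus the
    barrier, would have a positive maximum, kept off the sides and the final time by the choice of
    constants. There [v_t <= 0], [v_x = 0] and [v_xx <= 0], whence [u_t + L_X u <= 3 l / 4 < l]. *)
Lemma parabolic_subsolution_negative (R : realType) (mu sigma : R -> R)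
    (c t0 x1 x2 l : R) (u ut ux uxx : R -> R -> R) :
  c < t0 -> x1 < x2 -> 0 < l ->
  {within `[x1, x2], continuous mu} -> {within `[x1, x2], continuous sigma} ->
  {within `[c, t0] `*` `[x1, x2], continuous (fun z => u z.1 z.2)} ->
  (forall t x, c < t < t0 -> x1 < x < x2 ->
    [/\ is_derive t 1 (fun s => u s x) (ut t x),
        is_derive x 1 (fun y => u t y) (ux t x)
      & is_derive x 1 (fun y => ux t y) (uxx t x)]) ->
  (forall t x, c < t < t0 -> x1 < x < x2 ->
    l <= parabolic_op mu sigma ut ux uxx t x) ->
  (forall x, x1 <= x <= x2 -> u t0 x = 0) ->
  exists t x, [/\ c < t < t0, x1 < x < x2 & u t x < 0].
Proof.
move=> ct0 x12 l0 mu_c sigma_c u_c u_d u_op u_t0.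
pose x0 := (x1 + x2) / 2; pose r := (x2 - x1) / 2.
have r0 : 0 < r by rewrite /r; lra.
(* This function is [L_X] applied to [(x - x0)^2]. *)
have q_c : {within `[x1, x2], continuous
    (fun x => sigma x * sigma x + 2 * mu x * (x - x0))}.
  apply/subspace_continuousP => x xI.
  have /subspace_continuousP/(_ x xI) sx := sigma_c.
  have /subspace_continuousP/(_ x xI) mx := mu_c.
  apply: cvgD; first exact: cvgM.
  apply: cvgM; first by apply: cvgM => //; exact: cvg_cst.
  by apply: cvgB; [exact: cvg_within|exact: cvg_cst].
have [m m0 q_le] : exists2 m, 0 < m & forall x, x1 <= x <= x2 ->
    sigma x ^+ 2 + 2 * mu x * (x - x0) <= m.
  have [z _ zmax] := EVT_max (ltW x12) q_c.
  exists (`|sigma z * sigma z + 2 * mu z * (z - x0)| + 1); first by rewrite ltr_wpDl.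
  move=> x xx; rewrite expr2; apply: le_trans (zmax x _) _; first by rewrite in_itv.
  by rewrite ler_wpDr// ler_norm.
(* With this [K], the operator [L_X] applied to [K (x - x0)^2] is at most [l / 4]. *)
pose K := l / (4 * m); have K0 : 0 < K by rewrite divr_gt0// mulr_gt0.
have KmE : K * m = l / 4 by rewrite /K; field; rewrite gt_eqF.
(* On the sides the quadratic term equals [K r^2]. Continuity and [u t0 x = 0] let [u] use less than
   half of it near [t0]. *)
have side x : x1 <= x <= x2 -> exists2 a, c < a < t0 &
    forall t, a <= t <= t0 -> u t x < K * r ^+ 2 / 2.
  move=> xx.
  have cpos : 0 < K * r ^+ 2 / 2 by rewrite divr_gt0// mulr_gt0// exprn_gt0.
  have xQ : (`[c, t0] `*` `[x1, x2]) (t0, x).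
    by split; rewrite /= in_itv/=; lra.
  have /subspace_continuousP/(_ _ xQ)/= := u_c.
  rewrite /from_subspace /= u_t0// => /cvgr_lt/(_ _ cpos); rewrite near_withinE => /nbhs_ballP[e /= e0 ball_e].
  exists (Num.max ((c + t0) / 2) (t0 - e / 2)).
    by case: (leP ((c + t0) / 2) (t0 - e / 2)) => ?; lra.
  move=> t tat; have [ct te tt0] : [/\ c <= t, t0 - e < t & t <= t0].
    by move: tat; case: (leP ((c + t0) / 2) (t0 - e / 2)) => ? ?; split; lra.
  apply: (ball_e (t, x)); last by split; rewrite /= in_itv/=; lra.
  split=> /=; last exact: ballxx.
  by rewrite /ball/= ger0_norm ?subr_ge0//; lra.
have [a1 a1P side1] := side x1 ltac:(lra).
have [a2 a2P side2] := side x2 ltac:(lra).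
(* The time term uses at most the other half of [K r^2], so [v < 0] on both sides from [a] on. *)
have [a [ac a1a a2a aK]] : exists a, [/\ c < a < t0, a1 <= a, a2 <= a
    & l / 2 * (t0 - a) <= K * r ^+ 2 / 2].
  pose h := K * r ^+ 2 / l.
  have h0 : 0 < h by rewrite divr_gt0// mulr_gt0// exprn_gt0.
  have hE : l / 2 * h = K * r ^+ 2 / 2 by rewrite /h; field; rewrite gt_eqF.
  exists (Num.max (Num.max a1 a2) (t0 - h / 2)); split.
  - have /andP[ca1 a1t] := a1P; have /andP[_ a2t] := a2P.
    by rewrite !lt_max !gt_max ca1 a1t a2t gtrBl divr_gt0.
  - by rewrite !le_max lexx.
  - by rewrite !le_max lexx orbT.
  - rewrite -hE ler_pM2l ?divr_gt0// lerBlDr -lerBlDl le_max.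
    by apply/orP; right; lra.
exists a, x0; split => //; first by rewrite /x0; lra.
rewrite ltNge; apply/negP => ua.
pose v t x := u t x + l / 2 * (t0 - t) - K * (x - x0) ^+ 2.
have v_c : {within `[a, t0] `*` `[x1, x2], continuous (fun z => v z.1 z.2)}.
  have subQ : `[a, t0] `*` `[x1, x2] `<=` `[c, t0] `*` `[x1, x2].
    by move=> [t x] [tI xI]; split => //; move: tI; rewrite /= !in_itv/=; lra.
  have /subspace_continuousP uc := continuous_subspaceW subQ u_c.
  apply/subspace_continuousP => z zQ.
  have z1 : w.1 @[w --> within (`[a, t0] `*` `[x1, x2]) (nbhs z)] --> z.1.
    apply: cvg_trans (cvg_fst (F := nbhs z.1) (G := nbhs z.2)).
    by apply: cvg_app; exact: cvg_within.
  have z2 : w.2 @[w --> within (`[a, t0] `*` `[x1, x2]) (nbhs z)] --> z.2.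
    apply: cvg_trans (cvg_snd (F := nbhs z.1) (G := nbhs z.2)).
    by apply: cvg_app; exact: cvg_within.
  apply: cvgB.
    apply: cvgD; first exact: uc.
    by apply: cvgM; [exact: cvg_cst|apply: cvgB => //; exact: cvg_cst].
  apply: cvgM; first exact: cvg_cst.
  by apply: cvgM; apply: cvgB => //; exact: cvg_cst.
have [| |[ts xs]] := @compact_EVT_max _ _ _ _ _ _ v_c.
- by exists (a, x0); split; rewrite /= in_itv/= /x0; lra.
- by apply: compact_setX; exact: segment_compact.
rewrite inE => -[/=]; rewrite !in_itv/= => tsP xsP vmax.
have {}vmax t x : a <= t <= t0 -> x1 <= x <= x2 -> v t x <= v ts xs.
  by move=> ? ?; apply: (vmax (t, x)); rewrite inE; split; rewrite /= in_itv.
have vpos : 0 < v ts xs.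
  apply: lt_le_trans (vmax a x0 _ _); [|lra|by rewrite /x0; lra].
  by rewrite /v subrr expr0n mulr0 subr0 ltr_wpDl// mulr_gt0 ?divr_gt0//; lra.
have sqK x : 0 <= K * (x - x0) ^+ 2 by rewrite mulr_ge0 ?sqr_ge0// ltW.
have ts_lt : ts < t0.
  rewrite lt_neqAle; apply/andP; split; last lra.
  by apply/eqP => tsE; move: vpos; rewrite /v tsE u_t0//; have := sqK xs; lra.
have tsl : l / 2 * (t0 - ts) <= l / 2 * (t0 - a) by rewrite ler_pM2l ?divr_gt0//; lra.
have r1 : (x1 - x0) ^+ 2 = r ^+ 2 by rewrite /x0 /r; field.
have r2 : (x2 - x0) ^+ 2 = r ^+ 2 by rewrite /x0 /r; field.
have xs1 : x1 < xs.
  rewrite lt_neqAle; apply/andP; split; last lra.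
  apply/eqP => xsE; move: vpos; rewrite /v -xsE r1.
  by have := side1 ts ltac:(lra); lra.
have xs2 : xs < x2.
  rewrite lt_neqAle; apply/andP; split; last lra.
  apply/eqP => xsE; move: vpos; rewrite /v xsE r2.
  by have := side2 ts ltac:(lra); lra.
have xs12 : x1 < xs < x2 by lra.
have tsc : c < ts < t0 by lra.
have [dut dux duxx] := u_d ts xs tsc xs12.
(* The maximum may lie on the initial line [ts = a], so [v] is compared with later times only; this
   gives the sign of the derivative but not its vanishing. *)
have vt : ut ts xs - l / 2 <= 0.
  have dv : is_derive ts 1 (fun t => v t xs) (ut ts xs - l / 2).
    rewrite /v; apply: is_derive_eq; rewrite /GRing.scale/=; lra.
  rewrite leNgt; apply/negP => /(is_derive_gt0_incr_right _ _ _ _ dv)[e e0].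
  have [t [tst te tt0]] : exists t, [/\ ts < t, t < ts + e & t <= t0].
    exists (Num.min (ts + e / 2) t0); rewrite lt_min gt_min ge_min lexx orbT.
    by rewrite ltrDl divr_gt0//= ts_lt ltrD2l ltr_pdivrMr// ltr_pMr// ltr1n.
  move=> /(_ t); rewrite tst te => /(_ isT).
  by have := vmax t xs ltac:(lra) xsP; lra.
have [|x|||] := second_derivative_at_max R (v ts) (fun x => ux ts x - 2 * K * (x - x0))
  x1 x2 xs (uxx ts xs - 2 * K).
- by rewrite in_itv.
- rewrite in_itv/= => xP; have [_ dx _] := u_d ts x tsc xP.
  by rewrite /v; apply: is_derive_eq; rewrite /GRing.scale/=; lra.
- by apply: is_derive_eq; rewrite /GRing.scale/=; lra.
- by move=> x; rewrite in_itv/= => xP; apply: vmax; lra.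
move=> vx vxx; have := u_op ts xs tsc xs12; rewrite /parabolic_op.
have q := q_le xs xsP.
have Kq : K * (sigma xs ^+ 2 + 2 * mu xs * (xs - x0)) <= l / 4.
  by rewrite -KmE ler_pM2l.
have : sigma xs ^+ 2 * (uxx ts xs - 2 * K) <= 0 by rewrite mulr_ge0_le0// sqr_ge0.
have : mu xs * (ux ts xs - 2 * K * (xs - x0)) = 0 by rewrite vx mulr0.
lra.
Qed.

(** * Continuity of the coefficients and semicontinuity of the boundary *)

Lemma locally_lipschitz_continuous (R : realType) (f : R -> R) :
  locally_lipschitz f -> continuous f.
Proof.
move=> f_lip x.
have [k [_ /(_ (Num.max k 0 + 1))]] := f_lip (`|x| + 1).
(* The Lipschitz bound holds for every constant beyond [k]; this one is also positive, so [e / K]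
   makes sense as a radius. *)
set K := Num.max k 0 + 1.
have K0 : 0 < K by rewrite ltr_wpDl// le_max lexx orbT.
have kK : k < K by rewrite ltr_pwDr// le_max lexx.
move=> /(_ kK) lipK.
apply/cvgrPdist_lt => e e0.
near=> y.
have xy1 : `|x - y| < 1 by near: y; exact: cvgr_dist_lt.
have xy2 : `|x - y| < e / K by near: y; apply: cvgr_dist_lt => //; exact: divr_gt0.
have lipxy : `|f x - f y| <= K * `|x - y|.
  apply: (lipK (x, y)); split; rewrite /= in_itv/= -ler_norml ?lerDl//.
  have -> : y = x - (x - y) by rewrite subKr.
  by apply: le_trans (ler_normB _ _) _; rewrite lerD2l ltW.
by apply: le_lt_trans lipxy _; rewrite mulrC -ltr_pdivlMr.
Unshelve. all: by end_near. Qed.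

(** The point [(t, a)] lies in a relatively open set, so [(s, a)] stays in it for [s] near [t]. *)
Lemma open_strict_epigraph_usc (R : realType) (T : R) (b : R -> R) (t a : R) :
  open_in (strip T) [set z : R * R | 0 <= z.1 < T /\ b z.1 < z.2] ->
  0 <= t < T -> b t < a ->
  exists2 e : R, 0 < e &
    forall s, 0 <= s <= T -> `|t - s| < e -> b s < a.
Proof.
move=> [U U_open UE] tT bta.
have : (U `&` strip T) (t, a) by rewrite -UE.
move=> [Uta _]; have /nbhs_ballP[e /= e0 ball_e] := open_nbhs_nbhs (conj U_open Uta).
exists e => // s sT ts.
have : (U `&` strip T) (s, a).
  split=> //; apply: ball_e; split => //=; exact: ballxx.
by rewrite -UE => -[].
Qed.

(** * Exclusion of left jumps before the terminal time *)

(** If [y < b t0], a rectangle just before [t0] lies in the continuation set and its edge at [t0] in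
    the stopping set. The equation for [V] and the bound [- l] for [G] make [V - G] a strict
    subsolution, hence negative somewhere in the rectangle, where [V > G]. *)
Lemma free_boundary_no_left_jump (R : realType) (mu sigma : R -> R)
    (G V : R -> R -> R) (T : R) (b : R -> R) (t1 t0 y : R) :
  (exists Vt Vx Vxx : R -> R -> R,
     is_C12 (continuation_set T V G) (continuation_set T V G)° V Vt Vx Vxx /\
     forall t x : R, (continuation_set T V G)° (t, x) ->
       parabolic_op mu sigma Vt Vx Vxx t x = 0) ->
  continuous mu -> continuous sigma ->
  {within [set z : R * R | 0 < z.1 < T], continuous (fun z => V z.1 z.2)} ->
  continuation_set T V G = [set z : R * R | 0 <= z.1 < T /\ b z.1 < z.2] ->
  stopping_set T V G =
    [set z : R * R | 0 <= z.1 < T /\ z.2 <= b z.1] `|` [set z : R * R | z.1 = T] ->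
  (exists2 e : R, 0 < e & exists Gt Gx Gxx : R -> R -> R,
     let A := eball t0 (b t0) e `&` continuation_set T V G in
     is_C12 A (closure A) G Gt Gx Gxx /\
     exists2 l : R, 0 < l & forall s y : R, closure A (s, y) ->
       parabolic_op mu sigma Gt Gx Gxx s y <= - l) ->
  0 <= t1 < t0 -> t0 < T -> (forall s, t1 <= s < t0 -> b s <= y) -> b t0 <= y.
Proof.
move=> [Vt [Vx [Vxx [[V_d _] V_pde]]]] mu_c sigma_c V_c CE DE.
move=> [e e0 [Gt [Gx [Gxx [[G_d [G_c _ _ _]] [l l0 H_le]]]]]] t10 t0T b_le.
rewrite leNgt; apply/negP => yb; set A := _ `&` _ in G_d G_c H_le.
(* Both side lengths are at most [e / 2], so squared distances to [(t0, b t0)] are at most [e^2 / 2]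
   and the rectangle fits in the Euclidean ball. *)
have [c [c1 ce ct0]] : exists c, [/\ t1 < c, t0 - e / 2 <= c & c < t0].
  exists (Num.max ((t1 + t0) / 2) (t0 - e / 2)).
  by case: (leP ((t1 + t0) / 2) (t0 - e / 2)) => ?; split; lra.
have [x1 [yx1 ex1 x1b]] : exists x, [/\ y < x, b t0 - e / 2 <= x & x < b t0].
  exists (Num.max ((y + b t0) / 2) (b t0 - e / 2)).
  by case: (leP ((y + b t0) / 2) (b t0 - e / 2)) => ?; split; lra.
have QA t x : c <= t < t0 -> x1 <= x <= b t0 -> A (t, x).
  move=> tP xP; split; last by rewrite CE /=; have := b_le t ltac:(lra); split; lra.
  rewrite /eball /=; have : (t - t0) ^+ 2 <= (e / 2) ^+ 2.
    by rewrite -sqrrN ler_pXn2r ?nnegrE//; lra.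
  have : (x - b t0) ^+ 2 <= (e / 2) ^+ 2.
    by rewrite -sqrrN ler_pXn2r ?nnegrE//; lra.
  have : 0 < e ^+ 2 by rewrite exprn_gt0.
  by rewrite expr_div_n; lra.
(* The edge at [t0] is outside the continuation set; it is reached as a limit of earlier times,
   which gives continuity of [G] up to it. *)
have QclA : `[c, t0] `*` `[x1, b t0] `<=` closure A.
  move=> [t x] [/=]; rewrite !in_itv/= => tP xP.
  have [tt0|tt0] := ltP t t0; first by apply/subset_closure/QA; lra.
  have -> : t = t0 by lra.
  move=> B /nbhs_ballP[r /= r0 ball_r].
  have [s [cs rs st0]] : exists s, [/\ c <= s, t0 - r < s & s < t0].
    exists (Num.max c (t0 - r / 2)).
    by case: (leP c (t0 - r / 2)) => ?; split; lra.
  exists (s, x); split; first by apply: QA; lra.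
  apply: ball_r; split=> /=; last exact: ballxx.
  by rewrite /ball/= ger0_norm; lra.
have QintA t x : c < t < t0 -> x1 < x < b t0 -> A° (t, x).
  move=> tP xP; exists (`]c, t0[%classic, `]x1, b t0[%classic) => /=.
    by split; apply: near_in_itvoo; rewrite in_itv.
  by move=> [s z] [/=]; rewrite !in_itv/= => sP zP; apply: QA; lra.
have QintC t x : c < t < t0 -> x1 < x < b t0 -> (continuation_set T V G)° (t, x).
  by move=> tP xP; apply: interiorS (QintA t x tP xP) => z [].
have [||||t [x [tP xP]]] := parabolic_subsolution_negative R mu sigma c t0 x1 (b t0) l
  (fun t x => V t x - G t x) (fun t x => Vt t x - Gt t x)
  (fun t x => Vx t x - Gx t x) (fun t x => Vxx t x - Gxx t x) ct0 x1b l0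
  (continuous_subspaceT mu_c) (continuous_subspaceT sigma_c).
- have sub : `[c, t0] `*` `[x1, b t0] `<=` [set z : R * R | 0 < z.1 < T].
    by move=> [t x] [/=]; rewrite in_itv/= => tP _; lra.
  have /subspace_continuousP Vc := continuous_subspaceW sub V_c.
  have /subspace_continuousP Gc := continuous_subspaceW QclA G_c.
  by apply/subspace_continuousP => z zQ; apply: cvgB; [exact: Vc|exact: Gc].
- move=> t x tP xP.
  have [dt dx dxx] := V_d t x (QintC t x tP xP).
  have [et ex exx] := G_d t x (QintA t x tP xP).
  by split; exact: is_deriveB.
- move=> t x tP xP; have := V_pde t x (QintC t x tP xP).
  have /H_le : closure A (t, x) by apply: subset_closure; apply: interior_subset; exact: QintA.
  by rewrite /parabolic_op; lra.
- move=> x xP; have : stopping_set T V G (t0, x) by rewrite DE; left => /=; lra.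
  by case=> _ /= ->; rewrite subrr.
have [_ [_ /=]] := QA t x ltac:(lra) ltac:(lra); lra.
Qed.

(** * Continuity of the boundary from both sides *)

Theorem theorem3p2 (R : realType)
  (* complete probability space, Brownian motion, diffusion *)
  (d : measure_display) (Omega : measurableType d) (P : probability Omega R)
  (P_complete : measure_is_complete P)
  (B : R -> Omega -> R) (B_brownian : is_brownian_motion P B)
  (mu sigma : R -> R)
  (X : R -> R -> Omega -> R)
  (X_sde : forall x, unique_strong_solution P mu sigma B x (X x))
  (* gain function and value function on [0, T] x R *)
  (T : R) (T_gt0 : 0 < T)
  (G V : R -> R -> R)
  (V_value : forall t x : R, 0 <= t <= T ->
     (V t x)%:E = value P (completed_filtration P B) G X T t x)
  (* standing assumptions *)
  (tau_star_stopping : forall t x : R, 0 <= t <= T ->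
     stopping_time (completed_filtration P B) (T - t) (tau_star G V X T t x))
  (tau_star_optimal : forall t x : R, 0 <= t <= T ->
     payoff P G X t x (tau_star G V X T t x) = (V t x)%:E)
  (C_open : open_in (strip T) (continuation_set T V G))
  (D_closed : closed_in (strip T) (stopping_set T V G))
  (V_pde : exists Vt Vx Vxx : R -> R -> R,
     is_C12 (continuation_set T V G) (continuation_set T V G)° V Vt Vx Vxx /\
     forall t x : R, (continuation_set T V G)° (t, x) ->
       parabolic_op mu sigma Vt Vx Vxx t x = 0)
  (* (i) *)
  (mu_lip : locally_lipschitz mu) (sigma_lip : locally_lipschitz sigma)
  (mu_C2 : piecewise_Ck 2 mu)
  (sigma_gt0 : forall x, 0 < sigma x) (sigma_C3 : piecewise_Ck 3 sigma)
  (* (ii) *)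
  (G_usc : upper_semicontinuous_on (strip T) (fun z => G z.1 z.2))
  (* (iii) *)
  (V_cont : {within [set z : R * R | 0 < z.1 < T],
               continuous (fun z => V z.1 z.2)})
  (* (iv) *)
  (b : R -> R)
  (C_boundary : continuation_set T V G =
     [set z : R * R | 0 <= z.1 < T /\ b z.1 < z.2])
  (D_boundary : stopping_set T V G =
     [set z : R * R | 0 <= z.1 < T /\ z.2 <= b z.1] `|` [set z : R * R | z.1 = T])
  (* (iv) leaves b(T) free: it is read as the left limit of b, when it exists *)
  (b_T : forall l : R, b s @[s --> T^'-] --> l -> b T = l)
  (* (v) *)
  (G_C12 : forall t : R, 0 <= t < T ->
     exists2 e : R, 0 < e & exists Gt Gx Gxx : R -> R -> R,
       let A := eball t (b t) e `&` continuation_set T V G in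
       is_C12 A (closure A) G Gt Gx Gxx)
  (* (vi) *)
  (H_neg : forall t : R, 0 <= t < T ->
     exists2 e : R, 0 < e & exists Gt Gx Gxx : R -> R -> R,
       let A := eball t (b t) e `&` continuation_set T V G in
       is_C12 A (closure A) G Gt Gx Gxx /\
       exists2 l : R, 0 < l & forall s y : R, closure A (s, y) ->
         parabolic_op mu sigma Gt Gx Gxx s y <= - l)
  (* (vii) *)
  (kappa_bound : exists2 delta : R, 1 < delta & forall r : R, 0 < r ->
     (ereal_sup [set \int[lebesgue_measure]_(x in `[(- r)%R, r])
                       (`|kappa P G X T delta t x| `^ (delta^-1))%E
                | t in `[0%R, T]] < +oo)%E)
  (t1 t2 : R) (t1_ge0 : 0 <= t1) (t12 : t1 <= t2) (t2_leT : t2 <= T)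
  (b_incr : {in `[t1, t2] &, {homo b : s t / s <= t}}) :
  {within `[t1, t2], continuous b}.
Proof.
have mu_c := locally_lipschitz_continuous R mu mu_lip.
have sigma_c := locally_lipschitz_continuous R sigma sigma_lip.
rewrite C_boundary in C_open.
have b_le s t : t1 <= s -> s <= t -> t <= t2 -> b s <= b t.
  by move=> ? ? ?; apply: b_incr => //; rewrite in_itv/=; lra.
have no_left_jump t y : t1 < t <= t2 ->
    (forall s, t1 <= s < t -> b s <= y) -> b t <= y.
  move=> tP s_le; have [tT|Tt] := ltP t T.
    apply: (free_boundary_no_left_jump _ _ _ _ _ _ _ _ _ _ V_pde mu_c sigma_c
      V_cont C_boundary D_boundary (H_neg t _) _ tT s_le); lra.
  have tE : t = T by lra.
  have ubd : has_ubound (b @` `[t1, T[).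
    by exists y => _ [s /= sP <-]; apply: s_le; move: sP; rewrite in_itv/=; lra.
  have ne : b @` `[t1, T[ !=set0 by exists (b t1); exists t1; rewrite //= in_itv/=; lra.
  (* By monotonicity the left limit at [T] is the supremum of the earlier values. *)
  rewrite tE (b_T (sup (b @` `[t1, T[))).
    apply: ge_sup => // _ [s /= sP <-]; apply: s_le; move: sP; rewrite in_itv/=; lra.
  apply/cvgrPdist_le => e e0.
  have [_ [s0 /= s0P <-] s0e] := sup_adherent e0 (conj ne ubd).
  move: s0P; rewrite in_itv/= => s0P.
  near=> s.
  have sT : s < T by near: s; exact: nbhs_left_lt.
  have s0s : s0 < s by near: s; apply: nbhs_left_gt; lra.
  have := b_le s0 s ltac:(lra) ltac:(lra) ltac:(lra).
  have : b s <= sup (b @` `[t1, T[).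
    by apply: ub_le_sup => //; exists s; rewrite //= in_itv/=; lra.
  by move=> ? ?; rewrite ger0_norm; lra.
apply/subspace_continuousP => t /=; rewrite in_itv/= => tP.
apply/cvgrPdist_lt => e e0.
have [d1 d1_gt0 upper] : exists2 h, 0 < h &
    forall s, t1 <= s <= t2 -> `|t - s| < h -> b s < b t + e.
  (* At [t = T] every [s] is at most [t], so monotonicity suffices; before [T] semicontinuity is
     used. *)
  have [tT|Tt] := ltP t T; last first.
    exists 1 => // s sP _; have := b_le s t ltac:(lra) ltac:(lra) ltac:(lra); lra.
  have [||h h0 bh] := open_strict_epigraph_usc R T b t (b t + e) C_open; [lra|lra|].
  by exists h => // s sP; apply: bh; lra.
have [d2 d2_gt0 lower] : exists2 h, 0 < h &
    forall s, t1 <= s <= t2 -> `|t - s| < h -> b t - e < b s.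
  have [t1t|tt1] := ltP t1 t; last first.
    exists 1 => // s sP _; have := b_le t s ltac:(lra) ltac:(lra) ltac:(lra); lra.
  (* Otherwise [b t - e] would bound all earlier values, hence [b t] itself. Monotonicity then
     extends the estimate from [s0] to all later times. *)
  have [s0 s0P bs0] : exists2 s, t1 <= s < t & b t - e < b s.
    apply: contrapT => nex; have : b t <= b t - e; last lra.
    apply: no_left_jump => [|s sP]; first lra.
    by rewrite leNgt; apply/negP => bs; apply: nex; exists s.
  exists (t - s0); first lra.
  move=> s sP; rewrite ltr_norml => ?.
  by have := b_le s0 s ltac:(lra) ltac:(lra) ltac:(lra); lra.
rewrite near_withinE; near=> s; rewrite /= in_itv/= => sP.
have s1 : `|t - s| < d1 by near: s; exact: cvgr_dist_lt.
have s2 : `|t - s| < d2 by near: s; exact: cvgr_dist_lt.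
have := upper s sP s1; have := lower s sP s2; rewrite /from_subspace/= => ? ?.
by rewrite ltr_norml; lra.
Unshelve. all: by end_near. Qed.
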